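(* Let $r\geq 3$, $\ell_0\geq 4$ and $k\geq 0$ be integers, and let $\ell_1\geq \ell_2\geq\cdots\geq \ell_k$ be positive integers. Put $\ell=\max\{\ell_0,\ell_1\}$ if $k\geq 1$ and $\ell=\ell_0$ if $k=0$. Then for all sufficiently large $n$ (in terms of $r,k,\ell_0,\ell_1,\dots,\ell_k$), $$\mathrm{ex}_r^{\mathrm{lin}}\big(n,P_{\ell_0}^r\cup S_{\ell_1}^r\cup\cdots\cup S_{\ell_k}^r\big)\leq \Big(\frac{k}{r-1}+\frac{(2r-3)\ell}{2}\Big)(n-k)+\frac{k(k-1)}{r(r-1)}.$$
   Context: An $r$-graph ($r$-uniform hypergraph) $H=(V(H),E(H))$ is a finite vertex set together with a set of $r$-element subsets of it (edges). It is linear if any two distinct edges intersect in at most one vertex. The $r$-uniform linear path $P_\ell^r$ of length $\ell$ is the $r$-graph with edges $e_1,\dots,e_\ell$ such that $|e_i\cap e_j|=1$ if $|i-j|=1$ and $e_i\cap e_j=\emptyset$ for all other $i\neq j$ (with no vertices outside these edges). The $r$-uniform linear star $S_\ell^r$ is the $r$-graph with $\ell$ edges obtained from the graph star with $\ell$ edges by inserting $r-2$ new distinct vertices in each edge (so all $\ell$ edges share one common vertex and are otherwise pairwise disjoint). $H\cup G$ denotes the disjoint union of hypergraphs $H$ and $G$. An $r$-graph is $F$-free if it contains no copy of $F$ as a (not necessarily induced) subgraph. The linear Turán number $\mathrm{ex}_r^{\mathrm{lin}}(n,F)$ is the maximum number of edges in an $F$-free linear $r$-graph on $n$ vertices. 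*)

(* Defs.v *)
From HB Require Import structures.
From mathcomp Require Import all_boot all_order all_algebra zify.
Set Implicit Arguments.
Unset Strict Implicit.
Unset Printing Implicit Defensive.

Record hypergraph := Hypergraph {
  vertex : finType;
  edges : {set {set vertex}}
}.

Definition uniform (r : nat) (H : hypergraph) : bool :=
  [forall e in edges H, #|e| == r].

Definition linear_hypergraph (H : hypergraph) : bool :=
  [forall e1 in edges H, [forall e2 in edges H,
     (e1 != e2) ==> (#|e1 :&: e2| <= 1)]].

(* The copy need not be induced: other edges of [H] may lie inside it. *)
Definition has_copy (F H : hypergraph) : bool :=
  [exists f : {ffun vertex F -> vertex H},
     injectiveb f && [forall e in edges F, (f @: e) \in edges H]].

Definition free (F H : hypergraph) : bool := ~~ has_copy F H.

(* Only hosts on the vertex set {0, ..., n-1} are considered; [leq_ex_lin]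
   shows that this loses no generality. *)
Definition ex_lin (r n : nat) (F : hypergraph) : nat :=
  \max_(E : {set {set 'I_n}} |
          [&& uniform r (Hypergraph E), linear_hypergraph (Hypergraph E)
            & free F (Hypergraph E)])
     #|E|.

(* The path has (r-1)l + 1 vertices; the i-th edge consists of the r consecutive
   vertices i(r-1), ..., (i+1)(r-1), so that the last vertex of an edge is the
   first one of the next edge. *)
Definition path_edge (r l : nat) (i : 'I_l) : {set 'I_(l * r.-1).+1} :=
  [set v : 'I_(l * r.-1).+1 | i * r.-1 <= v <= i.+1 * r.-1].

Definition linear_path (r l : nat) : hypergraph :=
  Hypergraph [set path_edge r i | i : 'I_l].

(* [None] is the centre; the [Some (i, j)] are the r-1 other vertices of the i-th
   edge, i.e. the leaf and the r-2 inserted vertices. *)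
Definition star_edge (r l : nat) (i : 'I_l) : {set option ('I_l * 'I_r.-1)} :=
  None |: [set Some (i, j) | j : 'I_r.-1].

Definition linear_star (r l : nat) : hypergraph :=
  Hypergraph [set star_edge r i | i : 'I_l].

Definition hunion (H G : hypergraph) : hypergraph :=
  @Hypergraph (vertex H + vertex G)%type
    ([set [set inl x | x in e] | e : {set vertex H} in edges H]
     :|: [set [set inr y | y in e] | e : {set vertex G} in edges G]).

Definition path_stars (r l0 : nat) (ls : seq nat) : hypergraph :=
  foldl hunion (linear_path r l0) [seq linear_star r l | l <- ls].

Lemma leq_ex_lin (r : nat) (F H : hypergraph) :
  uniform r H -> linear_hypergraph H -> free F H ->
  #|edges H| <= ex_lin r #|vertex H| F.
Proof.
case: H => V E /= uH lH fH.
pose g (e : {set V}) : {set 'I_#|V|} := enum_rank @: e.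
have ginj : injective g by apply: imset_inj; exact: enum_rank_inj.
have gE : #|g @: E| = #|E| by rewrite card_imset.
rewrite -gE /ex_lin; apply: (@leq_bigmax_cond _ _ (fun E0 : {set {set 'I_#|V|}} => #|E0|) (g @: E)).
apply/and3P; split.
- apply/forall_inP => e /imsetP[e0 e0E ->].
  rewrite card_imset; last exact: enum_rank_inj.
  exact: (forall_inP uH).
- apply/forall_inP => _ /imsetP[a aE ->]; apply/forall_inP => _ /imsetP[b bE ->].
  apply/implyP => nab; rewrite -imsetI; last by move=> x y _ _; apply: enum_rank_inj.
  rewrite card_imset; last exact: enum_rank_inj.
  have /implyP := forall_inP (forall_inP lH a aE) b bE; apply.
  by apply: contraNneq nab => ->.
- apply: contra fH => /existsP[/= f /andP[/injectiveP finj /forall_inP fE]].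
  apply/existsP; exists [ffun x => enum_val (f x)]; apply/andP; split.
    by apply/injectiveP => x y; rewrite !ffunE => /enum_val_inj /finj.
  apply/forall_inP => e eF; have /imsetP[e0 e0E feq] := fE e eF.
  suff -> : [ffun x => enum_val (f x)] @: e = e0 by [].
  have -> : [ffun x => enum_val (f x)] @: e = enum_val @: (f @: e).
    by rewrite -imset_comp; apply: eq_imset => x; rewrite !ffunE.
  rewrite feq -imset_comp -[RHS]imset_id.
  by apply: eq_imset => x /=; rewrite enum_rankK.
Qed.

Section PathStarSpec.
Variables (r l : nat).
Hypothesis r_ge2 : 1 < r.

Lemma path_edge_card (i : 'I_l) : #|path_edge r i| = r.
Proof.
have lti : i.+1 * r.-1 <= l * r.-1 by rewrite leq_mul2r ltn_ord orbT.
have h (j : 'I_r) : i * r.-1 + j < (l * r.-1).+1.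
  by have := ltn_ord j; rewrite mulSn in lti; lia.
have -> : path_edge r i = [set Ordinal (h j) | j : 'I_r].
  apply/setP => v; rewrite inE; apply/idP/imsetP => [/andP[h1 h2]|[j _ ->]] /=.
    have hj : v - i * r.-1 < r by rewrite mulSn in h2; lia.
    by exists (Ordinal hj) => //; apply: val_inj => /=; lia.
  by rewrite leq_addr mulSn /=; have := ltn_ord j; lia.
rewrite card_imset ?card_ord // => a b [] /eqP.
by rewrite eqn_add2l => /eqP/val_inj.
Qed.

Lemma path_edge_next (i j : 'I_l) :
  j = i.+1 :> nat -> #|path_edge r i :&: path_edge r j| = 1.
Proof.
move=> ji; have hv : j * r.-1 < (l * r.-1).+1.
  by rewrite ltnS leq_mul2r ltnW ?orbT.
apply/eqP/cards1P; exists (Ordinal hv); apply/setP => v.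
rewrite !inE -val_eqE /= !ji !mulSn; lia.
Qed.

Lemma path_edge_disjoint (i j : 'I_l) :
  i.+1 < j -> path_edge r i :&: path_edge r j = set0.
Proof.
move=> ij; apply/setP => v; rewrite !inE.
have : i.+2 * r.-1 <= j * r.-1 by rewrite leq_mul2r ij orbT.
rewrite !mulSn; lia.
Qed.

Lemma path_edge_cover : 0 < l -> cover (edges (linear_path r l)) = setT.
Proof.
move=> l_gt0; apply/setP => v; rewrite inE; apply/bigcupP.
have r0 : 0 < r.-1 by lia.
have vle : v <= l * r.-1 by rewrite -ltnS.
case: (ltnP (v %/ r.-1) l) => [hi|hi].
  exists (path_edge r (Ordinal hi)); first exact: imset_f.
  by rewrite inE /= leq_divM ltnW // ltn_ceil.
have hl : l.-1 < l by lia.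
exists (path_edge r (Ordinal hl)); first exact: imset_f.
rewrite inE /= prednK // vle andbT.
apply: leq_trans (leq_divM v r.-1).
by rewrite leq_mul2r (leq_trans (leq_pred _) hi) orbT.
Qed.

Lemma star_edge_card (i : 'I_l) : #|star_edge r i| = r.
Proof.
rewrite cardsU1 card_imset; last by move=> a b [].
rewrite card_ord; case: imsetP => [[]//|_]; lia.
Qed.

Lemma star_edgeI (i j : 'I_l) :
  i != j -> star_edge r i :&: star_edge r j = [set None].
Proof.
move=> ij; apply/setP => -[[a b]|]; last by rewrite !inE.
rewrite !inE /=; apply/negP => /andP[/imsetP[x _ [-> _]] /imsetP[y _ [ab _]]].
by rewrite ab eqxx in ij.
Qed.

Lemma card_edges_path : #|edges (linear_path r l)| = l.
Proof.
rewrite card_imset ?card_ord // => i j eij; apply: val_inj.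
wlog le_ij : i j eij / i <= j => [hw|].
  by case/orP: (leq_total i j) => h; [exact: hw|symmetry; exact: hw].
case: (ltngtP i j) le_ij => // ij _.
have := path_edge_card j.
move: ij; rewrite leq_eqVlt => /predU1P[ij|ij].
  by have := path_edge_next (esym ij); rewrite eij setIid; lia.
by have := path_edge_disjoint ij; rewrite eij setIid => ->; rewrite cards0; lia.
Qed.

Lemma card_edges_star : #|edges (linear_star r l)| = l.
Proof.
rewrite card_imset ?card_ord // => i j eij; apply/eqP/negPn/negP => ij.
have := star_edgeI ij; rewrite eij setIid => h.
by have := star_edge_card j; rewrite h cards1; lia.
Qed.

End PathStarSpec.

(* Main.v *)
Require Import Defs.
From mathcomp Require Import all_boot all_order all_algebra zify ring.

(** Why the bound holds. Fix a huge constant T and let U be the set of vertices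
    of degree at least T.

    Suppose first that U has at least k vertices, and keep exactly k of them. The
    edges avoiding U contain no path with l0 edges: given such a path, k disjoint stars
    centred at the vertices of U could be added one at a time, because a vertex
    already used spoils at most one edge at the next centre. Hence there are at
    most (2r-3) l0 (n-k) / 2 of them by the path theorem [linear_path_turan]. The
    edges that meet U are bounded by counting pairs: an edge that leaves U
    contains at least r-1 of the k(n-k) pairs joining U to its complement, an
    edge inside U contains r(r-1) of the k(k-1) ordered pairs in U, and no pair
    lies in two edges ([card_touching_pairs]). The two counts give exactly the
    claimed bound ([edges_many_high]).

    If U has at most k-1 vertices, the edges meeting U number at most
    (k-1)n/(r-1), which leaves a gap of n/(r-1) to the term kn/(r-1) of the bound.
    The remaining edges form a hypergraph of bounded degree. If it has a path with
    l0 edges, then some bounded set of vertices meets all its stars with l edges,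
    as otherwise k disjoint stars could be found greedily off the path. That set
    meets a bounded number of edges, and off it all degrees are below l. In all
    cases at most (2r-3) l n / 2 + O(1) edges avoid U ([edges_few_high]), and the
    constant is absorbed by the gap n/(r-1) once n is large.

    The path theorem says that a linear r-graph on w vertices without a path of
    l edges has at most (2r-3) l w / 2 edges. In a counterexample with w minimal,
    every nonempty set S of vertices meets more than (2r-3) l |S| / 2 edges. Take
    a longest path e_0, ..., e_(t-1), so that t < l, and a vertex v at its far
    end. Every other edge f at v meets the union Q of e_0, ..., e_(t-2); since these
    traces are disjoint, the large degree of v forces at least (r-2)(l+2) edges
    f to meet Q in a single vertex ([card_single_hits]). If that vertex appears
    first in e_c, then e_0, ..., e_c, f, e_(t-1), ..., e_(c+2) is again a
    longest path ([path_rotate]), a Posa rotation that creates new end vertices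
    in e_(c+2). This gives a set S of at least l-1 end vertices in the vertex set
    P of the path. Maximality of the rotated paths forces every edge at a vertex
    s of S to meet P or one of the at most r-2 vertices of f outside P in a
    second vertex ([rotated_endpoint_hits]). Counting the pairs inside P that
    meet S only once, S meets at most |S|(|P| + r-2 - (|S|+1)/2) edges
    ([card_touching]), and this is at most (2r-3) l |S| / 2: a contradiction
    ([no_maximal_path]). *)

Set Implicit Arguments.
Unset Strict Implicit.
Unset Printing Implicit Defensive.

(** * Counting edges of linear hypergraphs *)

Section Counting.
Variables (V : finType) (r : nat).
Implicit Types (E F : {set {set V}}) (e f h : {set V}) (A B S U W : {set V}).

Definition linear_edges E := forall e f x y, e \in E -> f \in E -> x != y ->
  x \in e -> y \in e -> x \in f -> y \in f -> e = f.
Definition uniform_edges E := forall e, e \in E -> #|e| = r.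

Definition edges_at E v := [set e : {set V} in E | v \in e].
Definition touching E S := [set e : {set V} in E | ~~ [disjoint e & S]].
Definition avoiding E S := [set e : {set V} in E | [disjoint e & S]].

Lemma card_touching_avoiding E S : #|touching E S| + #|avoiding E S| = #|E|.
Proof.
rewrite addnC -(cardsID [set e : {set V} | [disjoint e & S]] E); congr (_ + _).
  by apply: eq_card => e; rewrite !inE.
by apply: eq_card => e; rewrite !inE andbC.
Qed.

Lemma touchingP E S e :
  reflect (e \in E /\ exists2 x, x \in e & x \in S) (e \in touching E S).
Proof.
rewrite inE -setI_eq0; apply: (iffP andP) => [[eE /set0Pn[x]]|[eE [x xe xS]]].
  by rewrite inE => /andP[xe xS]; split=> //; exists x.
by split=> //; apply/set0Pn; exists x; rewrite inE xe.
Qed.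

Lemma linear_edges_sub E F : F \subset E -> linear_edges E -> linear_edges F.
Proof. by move=> /subsetP sFE lE e f x y /sFE eE /sFE fE; exact: lE. Qed.

Lemma uniform_edges_sub E F : F \subset E -> uniform_edges E -> uniform_edges F.
Proof. by move=> /subsetP sFE uE e /sFE; exact: uE. Qed.

Lemma avoiding_sub E S : avoiding E S \subset E.
Proof. by apply/subsetP => e; rewrite inE => /andP[]. Qed.

(** Two edges through s share no other vertex, so choosing in each edge of F
    a second vertex in A is injective. *)
Lemma card_edges_through E F s A : linear_edges E -> F \subset E ->
  (forall e, e \in F -> s \in e) ->
  (forall e, e \in F -> exists y, [/\ y \in A, y \in e & y != s]) ->
  #|F| <= #|A|.
Proof.
move=> lE /subsetP sFE sF hF.
pose w e := odflt s [pick y | [&& y \in A, y \in e & y != s]].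
have wP e : e \in F -> [/\ w e \in A, w e \in e & w e != s].
  move=> eF; rewrite /w; case: pickP => [y /and3P[]//|none].
  by have [y [h1 h2 h3]] := hF e eF; have := none y; rewrite h1 h2 h3.
rewrite -(card_in_imset (f := w) (D := mem F)); last first.
  move=> e f eF fF ef; have [_ h1 h2] := wP e eF; have [_ h3 _] := wP f fF.
  by apply: (lE e f (w e) s); rewrite ?sFE ?sF // ef.
by apply/subset_leq_card/subsetP => _ /imsetP[e eF ->]; have [] := wP e eF.
Qed.

(** The edges at s that reach a second vertex of P are charged to pairs
    {s, x} with x in P, and each pair pays once. The quadratic term on the left
    is the saving from pairs with both vertices in S, which would otherwise be
    counted from both sides; it is what lowers the coefficient of the path
    theorem from 2r-2 to 2r-3. *)
Lemma card_touching E m (P : {set V}) S :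
  linear_edges E -> S \subset P ->
  (forall s, s \in S -> exists2 T : {set V}, #|T| <= m &
     forall e, e \in E -> s \in e ->
       exists y, [/\ y \in P :|: T, y \in e & y != s]) ->
  2 * #|touching E S| + #|S| * #|S|.+1 <= 2 * #|S| * (#|P| + m).
Proof.
move=> lE; elim: {S}#|S| {-2}S (erefl #|S|) => [|n IHn] S.
  move/cards0_eq=> -> _ _; rewrite (_ : touching _ _ = set0) ?cards0 //.
  by apply/setP => e; rewrite !inE disjoint_sym disjoints_subset sub0set andbF.
move=> cS sSP hE.
have /card_gt0P[s sS] : 0 < #|S| by rewrite cS.
have cS' : #|S :\ s| = n by have := cardsD1 s S; rewrite sS cS; lia.
have sub : S :\ s \subset S by apply: subsetDl.
have := IHn (S :\ s) cS' (subset_trans sub sSP) (fun z zS => hE z (subsetP sub z zS)).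
rewrite cS'.
have split : #|touching E S| <=
    #|touching E (S :\ s)| + #|avoiding (edges_at E s) (S :\ s)|.
  apply: leq_trans (leq_card_setU _ _).1; apply/subset_leq_card/subsetP => e.
  case/touchingP=> eE [x xe xS].
  rewrite !inE eE /=; case: (boolP [disjoint e & S :\ s]) => //= dis.
  rewrite andbT; case: (eqVneq x s) xe => [->//|xs] xe.
  by move: dis; rewrite disjoint_subset => /subsetP/(_ x xe); rewrite !inE xs xS.
have [T cT hT] := hE s sS.
have : #|avoiding (edges_at E s) (S :\ s)| <= #|(P :\: S) :|: T|.
  apply: (@card_edges_through E _ s) => //.
  - by apply/subsetP => e; rewrite !inE => /andP[/andP[]].
  - by move=> e; rewrite !inE => /andP[/andP[]].
  move=> e; rewrite !inE => /andP[/andP[eE se] dis].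
  have [y [yP ye ys]] := hT e eE se; exists y; split=> //.
  move: yP; rewrite !inE => /orP[yP|->]; last by rewrite orbT.
  rewrite yP andbT; apply/orP; left; apply/negP => yS.
  by move: dis; rewrite disjoint_subset => /subsetP/(_ y ye); rewrite !inE ys yS.
have := (leq_card_setU (P :\: S) T).1.
have := cT; have := cardsD P S.
rewrite (setIidPr sSP) cS.
have := subset_leq_card sSP; rewrite cS.
move: #|touching E S| #|touching E (S :\ s)| #|avoiding _ _| split => a b c split.
move: #|_ :|: _| #|P :\: S| #|P| #|T| split => d u p q; clear; nia.
Qed.

Lemma card_touching_deg E A d : (forall v, v \in A -> #|edges_at E v| <= d) ->
  #|touching E A| <= #|A| * d.
Proof.
move=> hd; rewrite -sum_nat_const; apply: leq_trans (leq_sum _ hd).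
apply: leq_trans (_ : #|\bigcup_(v in A) edges_at E v| <= _).
  apply/subset_leq_card/subsetP => e /touchingP[eE [x xe xA]].
  by apply/bigcupP; exists x; rewrite // inE eE.
elim/big_rec2: _ => [|v s B _ IH]; first by rewrite cards0.
by apply: leq_trans (leq_card_setU _ _).1 _; rewrite leq_add2l.
Qed.

(** Double counting: a pair of distinct vertices lies in at most one edge. *)
Lemma sum_pairs_in_edges E (D : {set V * V}) :
  linear_edges E -> (forall p, p \in D -> p.1 != p.2) ->
  \sum_(e in E) #|[set p in D | (p.1 \in e) && (p.2 \in e)]| <= #|D|.
Proof.
move=> lE hD.
under eq_bigr => e _ do rewrite -sum1dep_card big_mkcondr /=.
rewrite exchange_big /= -sum1_card; apply: leq_sum => p pD.
rewrite -big_mkcondr sum1dep_card /= leqNgt; apply/negP => /card_gt1P[e [f [+ + ef]]].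
rewrite !inE => /and3P[eE e1 e2] /and3P[fE f1 f2].
by move/eqP: ef; apply; apply: (lE e f p.1 p.2) => //; apply: hD.
Qed.

Lemma card_offdiag A : #|[set p in setX A A | p.1 != p.2]| + #|A| = #|A| * #|A|.
Proof.
rewrite -cardsX -(cardsID [set p : V * V | p.1 != p.2] (setX A A)); congr (_ + _).
  by apply: eq_card => p; rewrite !inE.
rewrite -(card_imset (f := fun x : V => (x, x)) (mem A)); last by move=> x y [].
apply: eq_card => -[x y]; rewrite !inE /= negbK; apply/imsetP/and3P.
  by case=> z zA [-> ->].
by case=> /eqP <- xA _; exists x.
Qed.

(** An edge with a vertices in U, 0 < a < r, contains a(r-a) >= r-1 pairs
    crossing the boundary of U, and an edge inside U contains r(r-1) ordered pairs
    of U. Weighting the crossing pairs by r makes both kinds of edges carry weight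
    at least r(r-1). *)
Lemma card_touching_pairs E U : uniform_edges E -> linear_edges E ->
  r * r.-1 * #|touching E U| <= r * (#|U| * #|~: U|) + #|U| * #|U|.-1.
Proof.
move=> uE lE.
have h1 : \sum_(e in E) #|e :&: U| * #|e :\: U| <= #|U| * #|~: U|.
  rewrite -cardsX; apply: leq_trans (sum_pairs_in_edges lE (D := setX U (~: U)) _).
    apply: leq_sum => e _; rewrite -cardsX; apply/subset_leq_card/subsetP => -[x y].
    by rewrite !inE /= => /andP[/andP[-> ->] /andP[-> ->]].
  by move=> [x y]; rewrite !inE /= => /andP[xU]; apply: contraNneq => <-.
have h2 : \sum_(e in E) #|e :&: U| * #|e :&: U|.-1 <= #|U| * #|U|.-1.
  have off A : #|A| * #|A|.-1 = #|[set p in setX A A | p.1 != p.2]|.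
    by have := card_offdiag A; case: #|A| => [|a] /=; [|rewrite mulnS]; lia.
  rewrite off.
  apply: leq_trans (sum_pairs_in_edges lE (D := [set p in setX U U | p.1 != p.2]) _).
    apply: leq_sum => e _; rewrite off; apply/subset_leq_card/subsetP => -[x y].
    by rewrite !inE /= => /andP[/andP[/andP[-> ->] /andP[-> ->]] ->].
  by move=> [x y]; rewrite !inE /= => /andP[].
apply: leq_trans (leq_add (leq_mul (leqnn r) h1) h2).
rewrite big_distrr -big_split /= mulnC -sum_nat_const.
rewrite [X in _ <= X](bigID (fun e => e \in touching E U)) /=.
apply: leq_trans (leq_addr _ _); rewrite [X in _ <= X](eq_bigl (mem (touching E U))).
  apply: leq_sum => e /touchingP[eE [x xe xU]].
  have a0 : 0 < #|e :&: U| by apply/card_gt0P; exists x; rewrite inE xe.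
  have := cardsID U e; rewrite (uE e eE).
  move: #|_ :&: _| #|_ :\: _| a0 => a b a0 <-.
  case: a a0 => // a _; case: b => [|b] /=; clear; nia.
by move=> e; rewrite /= inE andbA andbb.
Qed.

End Counting.

(** * Paths and rotations *)

(** In a numbering with steps of length m, the positions im, ..., (i+1)m form
    the i-th edge; this finds the first edge containing position p. *)
Lemma block_index m t p : 0 < m -> 0 < p <= t * m ->
  p.-1 %/ m < t /\ (p.-1 %/ m) * m < p <= (p.-1 %/ m).+1 * m.
Proof.
move=> m0 /andP[p0 pt]; rewrite ltn_divLR // prednK // pt; split=> //.
by rewrite -[X in _ < X <= _]prednK // ltnS leq_divM -{1}(prednK p0) ltn_ceil.
Qed.

Section Paths.
Variables (V : finType) (r : nat).
Implicit Types (E F : {set {set V}}) (e f h : {set V}) (A B S U W : {set V}).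

(** A path is a family of edges indexed by all natural numbers, read below t
    only; rotating or extending it is then a change of indices. The boolean on
    the right is read as the number 0 or 1. *)
Definition path_in E (g : nat -> {set V}) t :=
  (forall i, i < t -> g i \in E) /\
  (forall i j, i < j -> j < t -> #|g i :&: g j| = (j == i.+1)).

Lemma card_meet1 E e f x : linear_edges E -> e \in E -> f \in E -> e != f ->
  x \in e -> x \in f -> e :&: f = [set x].
Proof.
move=> lE eE fE ef xe xf; apply/setP => y; rewrite !inE.
apply/andP/eqP => [[ye yf]|->//]; apply/eqP/negPn/negP => yx.
by move/eqP: ef; apply; apply: (lE e f y x).
Qed.

Lemma path_disjoint E g t i j x : path_in E g t -> i < t -> j < t ->
  x \in g i -> x \in g j -> i <= j.+1.
Proof.
move=> [_ hg] it jt xi xj; rewrite leqNgt; apply/negP => ij.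
have /eqP := hg j i (ltnW ij) it; rewrite (gtn_eqF ij) cards_eq0 => /eqP h.
by have := in_set0 x; rewrite -h inE xi xj.
Qed.

(** Otherwise e could be appended to the path: by linearity it shares only s
    with the last edge. *)
Lemma path_extend E g t e s : linear_edges E -> path_in E g t ->
  (forall g', ~ path_in E g' t.+1) -> 0 < t -> e \in E -> s \in e -> s \in g t.-1 ->
  e != g t.-1 -> exists j y, [/\ j < t.-1, y \in g j & y \in e].
Proof.
move=> lE hg nog t0 eE se sg ne.
case: (boolP [exists j : 'I_t.-1, ~~ [disjoint g j & e]]) => [/existsP[j]|].
  rewrite -setI_eq0 => /set0Pn[y]; rewrite inE => /andP[yj ye].
  by exists j, y.
rewrite negb_exists => /forallP dis; exfalso.
apply: (nog (fun j => if j == t then e else g j)); split=> [i|i j ij].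
  rewrite ltnS leq_eqVlt => /predU1P[->|it]; first by rewrite eqxx.
  by rewrite (ltn_eqF it); apply: hg.1.
rewrite ltnS leq_eqVlt => /predU1P[jt|jt].
  rewrite {}jt eqxx in ij *; rewrite (ltn_eqF ij).
  case: (ltnP i t.-1) => [it|it].
    have := dis (Ordinal it); rewrite /= negbK -setI_eq0 => /eqP ->.
    by rewrite cards0 gtn_eqF //; lia.
  have -> : i = t.-1 by lia.
  rewrite setIC (card_meet1 lE eE _ ne se) ?cards1 ?prednK ?eqxx //.
  by apply: hg.1; lia.
by rewrite (ltn_eqF jt) (ltn_eqF (ltn_trans ij jt)); apply: hg.2.
Qed.

(** The rotated path follows the old one up to [g c], crosses through f to its
    last edge and runs backwards, dropping [g c.+1]. Dropping that edge leaves f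
    free to meet it, which happens when f hits the vertex shared by [g c] and
    [g c.+1]. *)
Lemma path_rotate E g t c f : path_in E g t -> c.+2 < t -> f \in E ->
  #|f :&: g t.-1| = 1 -> #|f :&: g c| = 1 ->
  (forall j, j < t.-1 -> j != c -> j != c.+1 -> [disjoint f & g j]) ->
  path_in E (fun j => if j <= c then g j else
                      if j == c.+1 then f else g (t + c.+1 - j)) t.
Proof.
move=> hg ct fE ft fc dis.
have dis0 j : j < t.-1 -> j != c -> j != c.+1 -> #|f :&: g j| = 0.
  by move=> h1 h2 h3; apply/eqP; rewrite cards_eq0 setI_eq0 dis.
split=> [i it|i j ij jt].
  case: ifP => [_|ic]; first exact: hg.1.
  by case: ifP => // ic1; apply: hg.1; lia.
case: (leqP j c) => jc.
  by rewrite (leq_trans (ltnW ij) jc); apply: hg.2.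
case: (eqVneq j c.+1) => [jc1|jc1].
  have -> : i <= c by lia.
  rewrite setIC; case: (eqVneq i c) => [->|ic]; first by rewrite fc jc1 eqxx.
  by rewrite dis0 //; lia.
case: (leqP i c) => ic.
  rewrite hg.2; lia.
case: (eqVneq i c.+1) => [ic1|ic1].
  case: (eqVneq j c.+2) => [jc2|jc2].
    have -> : t + c.+1 - j = t.-1 by lia.
    by rewrite ft ic1 jc2 eqxx.
  by rewrite dis0; lia.
rewrite setIC hg.2; lia.
Qed.

(** The numbering runs along the path as in [path_edge], with the prescribed end
    vertex v at the last position. The induction appends one edge, so v has to be
    an arbitrary end vertex: the shared vertex w plays its role for the shorter
    path. *)
Lemma path_numbering E g t v :
  uniform_edges r E -> linear_edges E -> 1 < r -> path_in E g t ->
  (0 < t -> v \in g t.-1) -> (forall i, i < t.-1 -> v \notin g i) ->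
  exists phi : nat -> V,
    [/\ {in [pred p | p <= t * r.-1] &, injective phi},
        phi (t * r.-1) = v &
        forall i x, i < t -> (x \in g i) <->
          exists2 p, i * r.-1 <= p <= i.+1 * r.-1 & phi p = x].
Proof.
move=> uE lE r1; elim: t v => [|t IHt] v hg vt vnot.
  exists (fun=> v); split=> // p q; rewrite !inE mul0n; lia.
have vgt : v \in g t by apply: vt.
have gtE : g t \in E by apply: hg.1.
have hg' : path_in E g t by split=> [i it|i j ij jt]; [apply: hg.1|apply: hg.2] => //; lia.
have [w [wt wv wg wnot]] : exists w,
    [/\ w \in g t, w != v, 0 < t -> w \in g t.-1 & forall i, i < t.-1 -> w \notin g i].
  case: (posnP t) => t0.
    have /card_gt0P[w] : 0 < #|g t :\ v|.
      by have := cardsD1 v (g t); rewrite vgt uE //; lia.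
    by rewrite !inE => /andP[wv wt]; exists w; split=> // i; rewrite t0.
  have /cards1P[w hw] : #|g t.-1 :&: g t| == 1.
    by apply/eqP; rewrite hg.2 ?prednK ?eqxx //.
  have := set11 w; rewrite -hw inE => /andP[w1 w2]; exists w; split=> //.
    by apply: contraTneq w1 => ->; apply: vnot => /=; lia.
  by move=> i it; apply/negP => wi; have := path_disjoint hg _ _ w2 wi; lia.
have [phi [inj last_ mem_]] := IHt w hg' wg wnot.
pose s := rcons (enum (g t :\ w :\ v)) v.
have us : uniq s by rewrite rcons_uniq mem_enum !inE eqxx enum_uniq.
have ms x : (x \in s) = (x \in g t :\ w).
  rewrite mem_rcons inE mem_enum !inE; case: (eqVneq x v) => [->|//] /=.
  by rewrite eq_sym wv.
have ss : size s = r.-1.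
  rewrite -(card_uniqP us) (eq_card ms).
  by have := cardsD1 w (g t); rewrite wt uE //; lia.
pose psi p := if p <= t * r.-1 then phi p else nth v s (p - (t * r.-1).+1).
have psi_old p : p <= t * r.-1 -> psi p = phi p by rewrite /psi => ->.
have old p : p <= t * r.-1 -> psi p \in s -> False.
  move=> pt; rewrite psi_old // ms => h; move: (h); rewrite !inE => /andP[pw pgt].
  case: (posnP t) => t0.
    by move: pw pt; rewrite -last_ t0 leqn0 => + /eqP p0; rewrite p0 eqxx.
  have [i it pi] : exists2 i, i < t & i * r.-1 <= p <= i.+1 * r.-1.
    case: (posnP p) => p0; first by exists 0; rewrite // p0.
    have m0 : 0 < r.-1 by rewrite -subn1 subn_gt0.
    have pp : 0 < p <= t * r.-1 by rewrite p0.
    have [it /andP[h1 h2]] := block_index m0 pp.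
    by exists (p.-1 %/ r.-1) => //; rewrite h2 ltnW.
  have pgi : phi p \in g i by apply/mem_ => //; exists p.
  have ie : i = t.-1.
    have := path_disjoint hg (ltnSn t) (ltnW it : i < t.+1) pgt pgi.
    by clear -it t0; lia.
  have : #|g t.-1 :&: g t| = 1 by rewrite hg.2 ?prednK ?eqxx.
  rewrite -ie => /eqP/cards1P[z hz].
  have : w \in g i :&: g t by rewrite inE wt andbT ie wg.
  have : phi p \in g i :&: g t by rewrite inE pgi.
  by rewrite hz !inE => /eqP h1 /eqP h2; rewrite h1 h2 eqxx in pw.
have psi_new p : t * r.-1 < p <= t.+1 * r.-1 -> psi p = nth v s (p - (t * r.-1).+1)
    /\ p - (t * r.-1).+1 < size s.
  by case/andP=> h1 h2; rewrite /psi leqNgt h1 ss ltn_subLR // addSn ltnS addnC -mulSn.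
exists psi; split.
- move=> p q; rewrite !inE => pt qt.
  case: (leqP p (t * r.-1)) => pt'; case: (leqP q (t * r.-1)) => qt'.
  + by rewrite !psi_old //; apply: inj.
  + have [|e1 e2] := psi_new q; first by rewrite qt'.
    by move=> e; case: (old p pt'); rewrite e e1 mem_nth.
  + have [|e1 e2] := psi_new p; first by rewrite pt'.
    by move=> e; case: (old q qt'); rewrite -e e1 mem_nth.
  have [|-> e2] := psi_new q; first by rewrite qt'.
  have [|-> e1] := psi_new p; first by rewrite pt'.
  by move/eqP; rewrite nth_uniq //; lia.
- have [|-> e2] := psi_new (t.+1 * r.-1); first by rewrite mulSn; lia.
  rewrite (_ : _ - _ = (size s).-1); last by rewrite ss mulSn; lia.
  by rewrite nth_last last_rcons.
move=> i x; rewrite ltnS leq_eqVlt => /predU1P[->|it]; last first.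
  rewrite mem_ //; have le : i.+1 * r.-1 <= t * r.-1 by rewrite leq_mul2r it orbT.
  by split=> -[p pi <-]; exists p; rewrite ?psi_old //; lia.
split=> [xt|[p /andP[p1 p2] <-]]; last first.
  move: p1; rewrite leq_eqVlt => /predU1P[<-|p1]; first by rewrite psi_old // last_.
  have [|-> e2] := psi_new p; first by rewrite p1.
  by have := mem_nth v e2; rewrite ms inE => /andP[].
case: (eqVneq x w) => [->|xw].
  by exists (t * r.-1); rewrite ?psi_old // leqnn /= mulSn; lia.
have xs : x \in s by rewrite ms !inE xw.
have := xs; rewrite -index_mem ss => lt.
have pt : t * r.-1 < (t * r.-1).+1 + index x s <= t.+1 * r.-1.
  by rewrite addSn ltnS leq_addr mulSn addnC ltn_add2r.
exists ((t * r.-1).+1 + index x s); first by rewrite ltnW; case/andP: pt.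
have [-> _] := psi_new _ pt.
by rewrite addKn nth_index.
Qed.

(** The traces on Q of edges through v are disjoint, as two edges already meet
    in v outside Q. An edge uses one vertex of Q if it is one of the single hits
    and at least two otherwise. *)
Lemma card_single_hits E F v (Q : {set V}) :
  linear_edges E -> F \subset E -> v \notin Q ->
  (forall f, f \in F -> v \in f /\ ~~ [disjoint f & Q]) ->
  2 * #|F| <= #|Q| + #|[set x in Q | [exists f in F, f :&: Q == [set x]]]|.
Proof.
move=> lE /subsetP sFE vQ hF.
set X := [set x in Q | _].
have hits f : f \in F -> 0 < #|f :&: Q|.
  by move=> /hF[_]; rewrite -setI_eq0 card_gt0.
have disj f f' : f \in F -> f' \in F -> f != f' -> [disjoint f :&: Q & f' :&: Q].
  move=> fF f'F ff'; rewrite -setI_eq0; apply/eqP/setP => x; rewrite !inE.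
  apply/negP => /andP[/andP[xf xQ] /andP[xf' _]]; move/eqP: ff'; apply.
  apply: (lE f f' x v); rewrite ?sFE ?(hF _ _).1 //.
  by apply: contraNneq vQ => <-.
pose hX f := #|f :&: Q| == 1.
have sumQ : \sum_(f in F) #|f :&: Q| <= #|Q|.
  have tri : trivIset [set f :&: Q | f in F].
    apply/trivIsetP => _ _ /imsetP[f fF ->] /imsetP[f' f'F ->] ne.
    by apply: disj => //; apply: contraNneq ne => ->.
  have inj : {in F &, injective (fun f => f :&: Q)}.
    move=> f f' fF f'F eq; apply/eqP/negPn/negP => ne.
    have := disj f f' fF f'F ne; rewrite eq -setI_eq0 setIid => /eqP h.
    by have := hits f' f'F; rewrite h cards0.
  have := tri; rewrite /trivIset big_imset //= => /eqP ->.
  by apply/subset_leq_card/bigcupsP => _ /imsetP[f _ ->]; apply: subsetIr.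
have sumX : \sum_(f in F) hX f <= #|X|.
  rewrite -big_mkcondr /= sum1dep_card.
  pose p f := odflt v [pick x in f :&: Q].
  have pP f : (f \in F) && hX f -> f :&: Q = [set p f].
    case/andP=> fF /cards1P[x hx]; rewrite /p hx; case: pickP => [y|/(_ x)] /=.
      by rewrite inE => /eqP ->.
    by rewrite inE eqxx.
  rewrite -(card_in_imset (f := p)) => [|f f']; last first.
    rewrite !inE => hf hf' e; apply/eqP/negPn/negP => ne.
    have [fF f'F] : f \in F /\ f' \in F by case/andP: hf; case/andP: hf'.
    have := disj f f' fF f'F ne; rewrite -setI_eq0 pP // pP // e setIid.
    by move/eqP/setP/(_ (p f')); rewrite !inE eqxx.
  apply/subset_leq_card/subsetP => _ /imsetP[f + ->]; rewrite inE => hf.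
  have := pP f hf; have := set11 (p f) => + h; rewrite -h inE => /andP[_ pQ].
  rewrite inE pQ; apply/existsP; exists f; rewrite h eqxx andbT.
  by case/andP: hf.
apply: leq_trans (leq_add sumQ sumX); rewrite -big_split /=.
rewrite -sum1_card big_distrr /=; apply: leq_sum => f fF.
by rewrite muln1 /hX; have := hits f fF; case: #|_| => [|[|n]].
Qed.

Lemma path_covers (phi : nat -> V) (g : nat -> {set V}) t x : 1 < r ->
  (forall i x, i < t -> (x \in g i) <->
          exists2 p, i * r.-1 <= p <= i.+1 * r.-1 & phi p = x) ->
  0 < t -> (exists2 i, i < t & x \in g i) <-> (exists2 p, p <= t * r.-1 & phi p = x).
Proof.
move=> r1 mem t0; split=> [[i it /mem[]// p /andP[_ pi] <-]|[p pt <-]].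
  by exists p => //; rewrite (leq_trans pi) // leq_mul2r it orbT.
case: (posnP p) => p0; first by exists 0 => //; apply/mem => //; exists p; rewrite // p0.
have m0 : 0 < r.-1 by rewrite -subn1 subn_gt0.
have pp : 0 < p <= t * r.-1 by rewrite p0.
have [it /andP[h1 h2]] := block_index m0 pp.
by exists (p.-1 %/ r.-1) => //; apply/mem => //; exists p; rewrite // h2 ltnW.
Qed.

(** Let c be the first edge containing position p. Rotating through f makes
    [g c.+2] the last edge of a path of maximal length. Adding 2(r-1)-1 maps
    the positions c(r-1)+1, ..., (c+1)(r-1) onto those of the vertices of [g c.+2]
    outside the edge preceding it on the rotated path, hence onto end vertices; as
    the shift is injective, distinct hits p yield distinct end vertices. *)
Lemma rotated_endpoint_hits E g t v p f (phi : nat -> V) :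
  uniform_edges r E -> linear_edges E -> 1 < r -> path_in E g t ->
  (forall g', ~ path_in E g' t.+1) ->
  {in [pred p | p <= t * r.-1] &, injective phi} ->
  phi (t * r.-1) = v ->
  (forall i x, i < t -> (x \in g i) <->
     exists2 p, i * r.-1 <= p <= i.+1 * r.-1 & phi p = x) ->
  0 < p <= t.-2 * r.-1 -> f \in E -> v \in f -> f != g t.-1 -> phi p \in f ->
  (forall q, q <= t.-1 * r.-1 -> phi q \in f -> phi q = phi p) ->
  forall e, e \in E -> phi (p + r.-1.*2.-1) \in e ->
    exists y, [/\ y \in [set phi (val q) | q : 'I_(t * r.-1).+1] :|: f, y \in e
                & y != phi (p + r.-1.*2.-1)].
Proof.
move=> uE lE r1 hg nog inj lastv mem pt fE vf fg pf single e eE.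
set s := phi _ => se.
have m0 : 0 < r.-1 by rewrite -subn1 subn_gt0.
have [] := block_index m0 pt; set c := p.-1 %/ r.-1 => ct /andP[cp pc].
have {}ct : c.+2 < t by clear -ct; lia.
have t0 : 0 < t by clear -ct; lia.
set q := p + r.-1.*2.-1 in s se *.
have [qc cq] : c.+2 * r.-1 <= q /\ q < c.+3 * r.-1.
  by rewrite /q; move: cp pc m0; rewrite !mulSn; move: (c * r.-1) (r.-1) => a b; clear; lia.
have le_mul a b : a <= b -> a * r.-1 <= b * r.-1 by move=> ab; rewrite leq_mul2r ab orbT.
have qt : q < t * r.-1 by apply: leq_trans cq (le_mul _ _ _).
have pq : p < q by apply: leq_ltn_trans pc _; apply: leq_trans qc; rewrite ltn_mul2r m0 /=.
have ple : p <= t * r.-1 by apply: ltnW; apply: ltn_trans pq qt.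
have phi_inj a b : a <= t * r.-1 -> b <= t * r.-1 -> phi a = phi b -> a = b.
  by move=> ha hb; apply: inj.
have pgc : phi p \in g c.
  by apply/mem; [clear -ct; lia|exists p; rewrite // ltnW].
have sg : s \in g c.+2 by apply/mem => //; exists q; rewrite // qc ltnW.
have vg : v \in g t.-1.
  apply/mem; first by rewrite prednK.
  by exists (t * r.-1); rewrite // prednK // leqnn le_mul ?leq_pred.
have vnot i : i < t.-1 -> v \notin g i.
  move=> it; apply/negP => /mem[]; first by clear -it; lia.
  move=> b /andP[_ bi]; rewrite -lastv => e1.
  have le : i.+1 * r.-1 < t * r.-1 by rewrite ltn_mul2r m0 /=; clear -it; lia.
  have ble := leq_ltn_trans bi le.
  by move: (ble); rewrite (phi_inj _ _ (ltnW ble) (leqnn _) e1) ltnn.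
have meetv : f :&: g t.-1 = [set v].
  by apply: (card_meet1 lE) => //; apply: hg.1; rewrite prednK.
(* Any vertex of f in another edge of the path is the single hit phi p; its
   position excludes the edges before c, and [path_disjoint] those after c.+1. *)
have hg' : path_in E (fun j => if j <= c then g j else
              if j == c.+1 then f else g (t + c.+1 - j)) t.
  apply: path_rotate => //; first by rewrite meetv cards1.
    rewrite (card_meet1 lE fE _ _ pf pgc) ?cards1 //; first by apply: hg.1; clear -ct; lia.
    by apply: contraTneq vf => ->; apply: vnot; clear -ct; lia.
  move=> j jt jc jc1; rewrite disjoint_subset; apply/subsetP => y yf; apply/negP => yg.
  have jt' : j < t by clear -jt; lia.
  have [b /andP[_ bj] by_] := (mem j y jt').1 yg.
  have bt : b <= t.-1 * r.-1 by apply: leq_trans bj (le_mul _ _ _).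
  have bt2 : b <= t * r.-1 by apply: leq_trans bt (le_mul _ _ (leq_pred _)).
  have ebp : b = p by apply: phi_inj => //; apply: single; rewrite // by_.
  have ct' : c < t by clear -ct; lia.
  have yc : y \in g c by rewrite -by_ ebp.
  have := path_disjoint hg jt' ct' yg yc; have := path_disjoint hg ct' jt' yc yg.
  move=> h1 h2; have jc' : j.+1 <= c by clear -h1 h2 jc jc1; lia.
  by have := leq_trans bj (le_mul _ _ jc'); rewrite ebp leqNgt cp.
have sg' : s \in (if t.-1 <= c then g t.-1 else
              if t.-1 == c.+1 then f else g (t + c.+1 - t.-1)).
  rewrite leqNgt (_ : c < t.-1) /=; last by clear -ct; lia.
  rewrite gtn_eqF; last by clear -ct; lia.
  by rewrite (_ : _ - _ = c.+2) //; clear -ct; lia.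
have gP i y : i < t -> y \in g i -> y \in [set phi (val q) | q : 'I_(t * r.-1).+1].
  move=> it /mem[]// b /andP[_ bi] <-.
  have bt : b < (t * r.-1).+1 by rewrite ltnS (leq_trans bi) // le_mul.
  by apply/imsetP; exists (Ordinal bt).
(* The hit phi p is at an earlier position than s, and v is at the last one. *)
have sf : s \notin f.
  apply/negP => sf; case: (leqP q (t.-1 * r.-1)) => hq.
    by have := phi_inj _ _ (ltnW qt) ple (single q hq sf) => e1; rewrite e1 ltnn in pq.
  have st : s \in g t.-1.
    apply/mem; first by rewrite prednK.
    by exists q; rewrite // prednK // (ltnW hq) ltnW.
  have : s \in f :&: g t.-1 by rewrite inE sf.
  rewrite meetv inE -lastv => /eqP e1.
  by move: (qt); rewrite (phi_inj _ _ (ltnW qt) (leqnn _) e1) ltnn.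
case: (eqVneq e (g c.+2)) => [eg|ne].
  have /card_gt0P[y] : 0 < #|e :\ s|.
    by have := cardsD1 s e; rewrite se uE //; clear -r1; lia.
  rewrite !inE => /andP[ys ye]; exists y; split=> //.
  by rewrite inE (gP c.+2) // -eg.
have {}ne : e != (if t.-1 <= c then g t.-1 else
              if t.-1 == c.+1 then f else g (t + c.+1 - t.-1)).
  rewrite leqNgt (_ : c < t.-1) /=; last by clear -ct; lia.
  rewrite gtn_eqF; last by clear -ct; lia.
  by rewrite (_ : _ - _ = c.+2) //; clear -ct; lia.
have [j [y [jt yg ye]]] := path_extend lE hg' nog t0 eE se sg' ne.
exists y; split=> //.
  move: yg; case: ifP => [jc /gP yP|jc].
    by rewrite inE yP //; clear -jt; lia.
  case: ifP => [_ yf|jc1 /gP yP]; first by rewrite inE yf orbT.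
  by rewrite inE yP //; clear -jt jc jc1; lia.
apply: contraTneq yg => ->; case: ifP => [jc|jc].
  apply/negP => sj; have jt' : j < t by clear -jt; lia.
  by have := path_disjoint hg ct jt' sg sj; clear -jc; lia.
case: ifP => // jc1; apply/negP => /mem[]; first by clear -jt jc jc1; lia.
move=> b /andP[ib bi] eb.
have it : (t + c.+1 - j).+1 <= t by clear -jt jc jc1; lia.
have ci : c.+3 <= t + c.+1 - j by clear -jt; lia.
have bt := leq_trans bi (le_mul _ _ it).
move: ib; rewrite (phi_inj _ _ bt (ltnW qt) eb) => qi.
by have := leq_trans (le_mul _ _ ci) qi; rewrite leqNgt cq.
Qed.

End Paths.

(** * The number of edges of a linear hypergraph without a long path *)

Section PathTuran.
Variables (V : finType) (r : nat).
Implicit Types (E F : {set {set V}}) (e f h : {set V}) (A B S U W : {set V}).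

Lemma path_end_vertex E g t :
  uniform_edges r E -> linear_edges E -> 1 < r -> path_in E g t -> 0 < t ->
  exists2 v, v \in g t.-1 & forall i, i < t.-1 -> v \notin g i.
Proof.
move=> uE lE r1 hg t0; have gE : g t.-1 \in E by apply: hg.1; rewrite prednK.
case: (ltnP 1 t) => t1; last first.
  have /card_gt0P[v vg] : 0 < #|g t.-1| by rewrite uE // ltnW.
  by exists v => // i; clear -t1; lia.
have /card_gt0P[v] : 0 < #|g t.-1 :\: g t.-2|.
  rewrite cardsD uE // setIC hg.2; [|clear -t1; lia..].
  by case: eqP => _; clear -r1; lia.
rewrite inE => /andP[vn vg]; exists v => // i it; apply/negP => vi.
have h1 : t.-1 < t by clear -t1; lia.
have h2 : i < t by clear -it; lia.
have := path_disjoint hg h1 h2 vg vi => h.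
have ie : i = t.-2 by clear -it h; lia.
by rewrite -ie vi in vn.
Qed.

(** The Posa rotation argument: S collects the end vertices of all rotations at
    one end vertex v, and is too large for the number of edges that meet it. *)
Lemma no_maximal_path E g t l :
  uniform_edges r E -> linear_edges E -> 2 < r ->
  (forall S, S != set0 -> S \subset cover E ->
     (2 * r - 3) * l * #|S| < 2 * #|touching E S|) ->
  0 < t -> t < l -> path_in E g t -> (forall g', ~ path_in E g' t.+1) -> False.
Proof.
move=> uE lE r2 dense t0 tl hg nog.
have r1 : 1 < r by apply: ltnW.
have [v vg vnot] := path_end_vertex uE lE r1 hg t0.
have [phi [inj lastv mem]] := path_numbering uE lE r1 hg (fun=> vg) vnot.
have gE : g t.-1 \in E by apply: hg.1; rewrite prednK.
pose P := [set phi (val q) | q : 'I_(t * r.-1).+1].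
pose Q := [set phi (val q) | q : 'I_(t.-1 * r.-1).+1].
have le_mul a b : a <= b -> a * r.-1 <= b * r.-1 by move=> ab; rewrite leq_mul2r ab orbT.
have m0 : 0 < r.-1 by rewrite -subn1 subn_gt0.
have phi_inj a b : a <= t * r.-1 -> b <= t * r.-1 -> phi a = phi b -> a = b.
  by move=> ha hb; apply: inj.
have QP b : b <= t.-1 * r.-1 -> b <= t * r.-1.
  by move=> bt; apply: leq_trans bt (le_mul _ _ (leq_pred _)).
have inP b : b <= t * r.-1 -> phi b \in P.
  by move=> bt; apply/imsetP; exists (Ordinal (bt : b < _.+1)).
have inQ b : b <= t.-1 * r.-1 -> phi b \in Q.
  by move=> bt; apply/imsetP; exists (Ordinal (bt : b < _.+1)).
have cP : #|P| = (t * r.-1).+1.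
  rewrite card_imset ?card_ord // => a b /phi_inj ab; apply: val_inj; apply: ab.
    by rewrite -ltnS ltn_ord.
  by rewrite -ltnS ltn_ord.
have cQ : #|Q| <= (t.-1 * r.-1).+1.
  by apply: leq_trans (leq_imset_card _ _) _; rewrite card_ord.
have lastlt : t.-1 * r.-1 < t * r.-1 by rewrite ltn_mul2r m0 /= prednK.
have vQ : v \notin Q.
  apply/negP => /imsetP[[b /= bt] _]; rewrite -lastv => /phi_inj e1.
  have e2 := e1 (leqnn _) (QP _ bt); move: bt; rewrite -e2 ltnS.
  by rewrite leqNgt lastlt.
pose F := edges_at E v :\ g t.-1.
have sFE : F \subset E by apply/subsetP => f; rewrite !inE => /and3P[].
have hF f : f \in F -> v \in f /\ ~~ [disjoint f & Q].
  rewrite !inE => /and3P[fg fE vf]; split=> //.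
  have [j [y [jt yg yf]]] := path_extend lE hg nog t0 fE vf vg fg.
  rewrite -setI_eq0; apply/set0Pn; exists y; rewrite inE yf.
  have /mem[] := yg; first by clear -jt; lia.
  by move=> b /andP[_ bj] <-; apply: inQ; apply: leq_trans bj (le_mul _ _ jt).
have := card_single_hits lE sFE vQ hF.
set X := [set x in Q | _] => cX.
have deg : (2 * r - 3) * l < 2 * #|F|.+1.
  have v0 : [set v] != set0 by apply/set0Pn; exists v; rewrite inE.
  have vE : [set v] \subset cover E.
    by rewrite sub1set; apply/bigcupP; exists (g t.-1).
  have := dense _ v0 vE; rewrite cards1 muln1 (_ : touching E _ = edges_at E v).
    by have := cardsD1 (g t.-1) (edges_at E v); rewrite !inE gE vg /= => ->.
  apply/setP => e; apply/touchingP/idP => [[eE [x xe]]|].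
    by rewrite !inE eE => /eqP <-.
  by rewrite !inE => /andP[eE ve]; split=> //; exists v; rewrite ?inE.
(* The hits at position 0 and in the last r-1 positions of Q are discarded:
   position 0 lies outside the blocks c(r-1)+1, ..., (c+1)(r-1), and the rotation
   at one of the others would drop the last edge. *)
pose J := [set p : 'I_(t * r.-1).+1 | (0 < p <= t.-2 * r.-1) && (phi p \in X)].
pose S := [set phi (val p + r.-1.*2.-1) | p in J].
have shift_le p : 0 < p <= t.-2 * r.-1 -> p + r.-1.*2.-1 <= t * r.-1.
  case/andP=> p0 pt; have t2 : 1 < t.
    by case: (t) p0 pt => [|[|?]] //=; rewrite mul0n; clear; lia.
  move: pt; have -> : t * r.-1 = t.-2 * r.-1 + r.-1.*2.
    by case: (t) t2 => [|[|s]] // _; rewrite !mulSn -addnn /=; clear; lia.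
  by move: (t.-2 * _) => a; clear; lia.
have cS : #|S| = #|J|.
  rewrite card_in_imset // => p q; rewrite !inE => /andP[hp _] /andP[hq _].
  move=> /(phi_inj _ _ (shift_le _ hp) (shift_le _ hq))/eqP.
  by rewrite eqn_add2r => /eqP/val_inj.
(* K covers the vertices at the discarded positions, at most r in number. *)
have cXJ : #|X| <= #|J| + r.
  pose K := [set phi (if i == 0 :> nat then 0 else t.-2 * r.-1 + i) | i : 'I_r].
  have cK : #|K| <= r by apply: leq_trans (leq_imset_card _ _) _; rewrite card_ord.
  apply: leq_trans (leq_add (leqnn _) cK).
  apply: (@leq_trans (#|(fun p : 'I_ _ => phi p) @: J| + #|K|)); last first.
    by rewrite leq_add2r leq_imset_card.
  apply: leq_trans (leq_card_setU _ _).1; apply/subset_leq_card/subsetP => x xX.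
  have : x \in Q by move: xX; rewrite inE => /andP[].
  case/imsetP=> -[b /= bt _ ex]; rewrite inE.
  case: (posnP b) => b0.
    apply/orP; right; apply/imsetP; exists (Ordinal (ltnW r1)) => //.
    by rewrite ex b0.
  case: (leqP b (t.-2 * r.-1)) => bt'.
    apply/orP; left; apply/imsetP; exists (Ordinal (QP _ bt : b < _.+1)) => //.
    by rewrite inE /= b0 bt' -ex.
  apply/orP; right; apply/imsetP.
  have lt : b - t.-2 * r.-1 < r.
    move: bt; have : t.-1 * r.-1 <= t.-2 * r.-1 + r.-1.
      by case: (t) => [|[|s]] //=; rewrite mulSn addnC.
    by move: (t.-1 * _) (t.-2 * _) => a c; clear -r1; lia.
  exists (Ordinal lt) => //=; rewrite ex subn_eq0 leqNgt bt' /=.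
  by rewrite subnKC // ltnW.
have lS : l <= #|S|.+1.
  rewrite cS; move: deg cX cXJ cQ r2 tl t0.
  move: #|F| #|X| #|J| #|Q| => a b c d.
  case: (r) => [//|m] /=; case: (t) => [//|t'] /=; clear.
  nia.
have S0 : S != set0 by rewrite -card_gt0; clear -lS tl t0; lia.
have SP : S \subset P.
  apply/subsetP => _ /imsetP[p + ->]; rewrite inE => /andP[hp _].
  by apply: inP; apply: shift_le.
have SE : S \subset cover E.
  apply: (subset_trans SP); apply/subsetP => _ /imsetP[[b bt] _ ->].
  have [i it xi] := (path_covers (phi b) r1 mem t0).2 (ex_intro2 _ _ b bt erefl).
  by apply/bigcupP; exists (g i) => //; apply: hg.1.
have := dense S S0 SE.
have hits s : s \in S -> exists2 T : {set V}, #|T| <= r.-2 &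
    forall e, e \in E -> s \in e ->
      exists y, [/\ y \in P :|: T, y \in e & y != s].
  case/imsetP=> p + ->; rewrite inE => /andP[pt].
  rewrite inE => /andP[pQ /existsP[f /andP[fF /eqP fQ]]].
  move: (fF); rewrite !inE => /and3P[fg fE vf].
  have pf : phi p \in f by have := set11 (phi p); rewrite -fQ inE => /andP[].
  exists (f :\: P).
    rewrite cardsD uE //.
    have : #|[set phi p; v]| <= #|f :&: P|.
      apply/subset_leq_card/subsetP => x; rewrite !inE => /orP[]/eqP->.
        by rewrite pf inP // -ltnS.
      by rewrite vf -lastv inP.
    rewrite cards2 (_ : phi p != v); first by move: #|_ :&: _| => a; clear; lia.
    by apply: contraNneq vQ => <-.
  move=> e eE se.
  have [|y [yP ye ys]] := rotated_endpoint_hits uE lE r1 hg nog inj lastv mem pt fE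
    vf fg pf _ eE se.
    move=> q qt qf; have : phi q \in f :&: Q by rewrite inE qf inQ.
    by rewrite fQ inE => /eqP.
  exists y; split=> //; move: yP; rewrite !inE.
  by case: (y \in P) => //=.
have := card_touching lE SP hits.
rewrite cP; move: S0 lS r2 tl t0; rewrite -card_gt0.
move: #|S| #|touching E S| => s u.
case: (r) => [//|[//|m]] /=; clear => s0 ls _ tl t0 h1 h2.
(* Here r = m + 2, so |P| + (r-2) is at most l(r-1), as t < l. *)
have h3 : 2 * s * ((t * m.+1).+1 + m) <= 2 * s * (l * m.+1).
  by rewrite leq_mul2l; apply/orP; right; nia.
have h4 : s * l <= s * s.+1 by rewrite leq_mul2l ls orbT.
nia.
Qed.

(** In a minimal counterexample, deleting S removes more than its share of
    edges, which is the density hypothesis of [no_maximal_path]. So a path can be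
    lengthened until it has l edges, starting from a single edge. *)
Lemma linear_path_turan l E W :
  2 < r -> 1 < l -> uniform_edges r E -> linear_edges E ->
  (forall e, e \in E -> e \subset W) -> (forall g, ~ path_in E g l) ->
  2 * #|E| <= (2 * r - 3) * l * #|W|.
Proof.
move=> r2 l1; elim: {W}_.+1 {-2}W (ltnSn #|W|) E => // n IHn W cW E uE lE EW nog.
rewrite leqNgt; apply/negP => big.
have dense S : S != set0 -> S \subset cover E ->
    (2 * r - 3) * l * #|S| < 2 * #|touching E S|.
  move=> S0 SE; have SW : S \subset W.
    by apply: subset_trans SE _; apply/bigcupsP => e /EW.
  have cWS : #|W :\: S| + #|S| = #|W|.
    by rewrite cardsD (setIidPr SW) subnK // subset_leq_card.
  have sub := avoiding_sub E S.
  have lt : #|W :\: S| < n by rewrite -card_gt0 in S0; clear -cWS cW S0; lia.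
  have avW e : e \in avoiding E S -> e \subset W :\: S.
    by rewrite inE => /andP[eE dis]; rewrite subsetD EW.
  have avnog g : ~ path_in (avoiding E S) g l.
    move=> [h1 h2]; apply: (nog g); split=> // i il.
    by apply: (subsetP sub); apply: h1.
  have := IHn _ lt _ (uniform_edges_sub sub uE) (linear_edges_sub sub lE) avW avnog.
  move: big; rewrite -cWS -(card_touching_avoiding E S) !mulnDr.
  move: ((2 * r - 3) * l) => K; move: (K * _) (K * _) => a b.
  by move: #|touching E S| #|avoiding E S|; clear; lia.
have E0 : 0 < #|E|.
  by case: #|E| big => //; rewrite muln0.
have none t : 0 < t -> t <= l -> forall g, ~ path_in E g t.
  move=> t0 tl; rewrite -(subKn tl); have : l - t < l by clear -t0 tl; lia.
  elim: (l - t) => [|k IHk] kl g; first by rewrite subn0; apply: nog.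
  move=> hg; apply: (no_maximal_path uE lE r2 dense _ _ hg).
  - by clear -kl; lia.
  - by clear -kl; lia.
  by rewrite (_ : (l - k.+1).+1 = l - k); [apply: IHk; clear -kl; lia|clear -kl; lia].
have /card_gt0P[e eE] := E0.
apply: (none 1 _ _ (fun=> e)) => //; first exact: ltnW.
by split=> // i j; clear; lia.
Qed.

End PathTuran.

(** * Copies of the path and of the stars *)

Section Copies.
Variables (V : finType) (r : nat).
Implicit Types (E F : {set {set V}}) (e f h : {set V}) (A B S U W : {set V}).

(** Recording the exact vertex set of the copy keeps track of disjointness and of
    the number of used vertices while copies are assembled. *)
Definition copy_on (G : hypergraph) E A := exists f : vertex G -> V,
  [/\ injective f, forall e : {set vertex G}, e \in edges G -> f @: e \in E & A = f @: setT].

Lemma copy_on_has G E A : copy_on G E A -> has_copy G (Hypergraph E).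
Proof.
case=> f [inj fE _]; apply/existsP; exists [ffun x => f x]; apply/andP; split.
  by apply/injectiveP => x y; rewrite !ffunE; apply: inj.
apply/forall_inP => e eG /=; rewrite (eq_imset (g := f)) ?fE // => x.
by rewrite ffunE.
Qed.

Lemma copy_on_card G E A : copy_on G E A -> #|A| = #|vertex G|.
Proof. by case=> f [inj _ ->]; rewrite card_imset // cardsT. Qed.

Lemma copy_on_sub G E F A : E \subset F -> copy_on G E A -> copy_on G F A.
Proof.
by move=> /subsetP sEF [f [inj fE ->]]; exists f; split=> // e /fE/sEF.
Qed.

Lemma copy_hunion G H E A B : copy_on G E A -> copy_on H E B -> [disjoint A & B] ->
  copy_on (hunion G H) E (A :|: B).
Proof.
move=> [f [finj fE ->]] [g [ginj gE ->]] dis.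
have fg x y : f x = g y -> False.
  move=> xy; move: dis; rewrite disjoint_subset => /subsetP/(_ (f x)).
  by rewrite imset_f // inE xy imset_f // => /(_ isT).
exists (fun z => match z with inl x => f x | inr y => g y end); split.
- by move=> [x|x] [y|y] => [/finj->|/fg|/esym/fg|/ginj->].
- by move=> _ /setUP[]/imsetP[e eE ->]; rewrite -imset_comp; [apply: fE|apply: gE].
apply/setP => v; rewrite inE; apply/orP/imsetP.
  by case=> /imsetP[x _ ->]; [exists (inl x)|exists (inr x)].
by case=> [[x|x] _ ->]; [left|right]; apply: imset_f.
Qed.

Lemma copy_path E g l :
  uniform_edges r E -> linear_edges E -> 1 < r -> 0 < l -> path_in E g l ->
  exists2 A, copy_on (linear_path r l) E A & A \subset cover E.
Proof.
move=> uE lE r1 l0 hg.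
have [v vg vnot] := path_end_vertex uE lE r1 hg l0.
have [phi [inj _ mem]] := path_numbering uE lE r1 hg (fun=> vg) vnot.
exists [set phi (val p) | p in [set: 'I_(l * r.-1).+1]].
  exists (fun p : 'I_(l * r.-1).+1 => phi p); split=> //.
    by move=> p q /inj pq; apply: val_inj; apply: pq; rewrite inE -ltnS.
  move=> _ /imsetP[i _ ->]; rewrite (_ : _ @: _ = g i); first by apply: hg.1.
  apply/setP => x; apply/imsetP/idP => [[p]|].
    by rewrite inE => pi ->; apply/mem => //; exists p.
  case/mem=> // p pi <-.
  have pl : p < (l * r.-1).+1.
    by case/andP: pi => _ /leq_trans; apply; rewrite leq_mul2r ltn_ord orbT.
  by exists (Ordinal pl) => //; rewrite inE.
apply/subsetP => _ /imsetP[[p pl] _ ->].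
have [i il xi] := (path_covers (phi p) r1 mem l0).2 (ex_intro2 _ _ p pl erefl).
by apply/bigcupP; exists (g i) => //; apply: hg.1.
Qed.

Lemma copy_star E F v l :
  uniform_edges r E -> linear_edges E -> F \subset edges_at E v -> l <= #|F| ->
  exists2 B, copy_on (linear_star r l) E B & B \subset v |: cover F.
Proof.
move=> uE lE sFE lF.
pose h (i : 'I_l) := nth set0 (enum F) i.
have hs (i : 'I_l) : i < size (enum F) by rewrite -cardE (leq_trans _ lF).
have hF i : h i \in F by rewrite -mem_enum mem_nth.
have hE i : h i \in E /\ v \in h i.
  by have := subsetP sFE _ (hF i); rewrite inE => /andP[].
have hinj i j : h i = h j -> i = j.
  by move/eqP; rewrite nth_uniq ?enum_uniq // => /eqP/val_inj.
pose f (z : option ('I_l * 'I_r.-1)) :=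
  if z is Some (i, j) then nth v (enum (h i :\ v)) j else v.
have sz i : size (enum (h i :\ v)) = r.-1.
  by have [h1 h2] := hE i; rewrite -cardE; have := cardsD1 v (h i); rewrite h2 uE // => ->.
have fh i j : f (Some (i, j)) != v /\ f (Some (i, j)) \in h i.
  have : f (Some (i, j)) \in h i :\ v by rewrite -mem_enum mem_nth ?sz.
  by rewrite !inE => /andP[].
have finj : injective f.
  move=> [[i j]|] [[i' j']|] e1 //; last by case: (fh i' j'); rewrite -e1 eqxx.
    2: by case: (fh i j); rewrite e1 eqxx.
  have [h2 h1] := fh i j; have [_ h3] := fh i' j'.
  have ii' : i = i'.
    apply: hinj; have [h4 h5] := hE i; have [h6 h7] := hE i'.
    by apply: (lE _ _ (f (Some (i, j))) v) => //; rewrite e1.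
  move: e1; rewrite -ii' => /eqP; rewrite /f nth_uniq ?sz ?enum_uniq //.
  by move=> /eqP/val_inj ->.
exists (f @: setT).
  exists f; split=> // _ /imsetP[i _ ->].
  rewrite (_ : f @: _ = h i); first by case: (hE i).
  apply/setP => x; apply/imsetP/idP => [[z + ->]|xh].
    rewrite !inE => /orP[/eqP->|/imsetP[j _ ->]]; first by case: (hE i).
    by case: (fh i j).
  case: (eqVneq x v) => [->|xv]; first by exists None; rewrite ?inE.
  have xe : x \in enum (h i :\ v) by rewrite mem_enum !inE xv.
  have lt : index x (enum (h i :\ v)) < r.-1 by rewrite -(sz i) index_mem.
  exists (Some (i, Ordinal lt)); last by rewrite /f /= nth_index.
  by rewrite !inE; apply/orP; right; apply: imset_f.
apply/subsetP => _ /imsetP[[[i j]|] _ ->]; rewrite !inE ?eqxx //.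
by apply/orP; right; apply/bigcupP; exists (h i) => //; case: (fh i j).
Qed.

(** I j A is the invariant that j more stars can be found off the used set A; each
    star consumes one unit of j. *)
Lemma copy_stars_greedily E l (I : nat -> {set V} -> Prop) :
  (forall j A m, I j.+1 A -> m <= l ->
     exists B, [/\ copy_on (linear_star r m) E B, [disjoint A & B] & I j (A :|: B)]) ->
  forall ls G A, all (leq^~ l) ls -> copy_on G E A -> I (size ls) A ->
  has_copy (foldl hunion G [seq linear_star r m | m <- ls]) (Hypergraph E).
Proof.
move=> step; elim=> [|m ls IHls] G A /=; first by move=> _ /copy_on_has.
case/andP=> ml lsl cG /step/(_ ml)[B [cB dis IAB]].
by apply: (IHls _ (A :|: B)) => //; apply: copy_hunion.
Qed.

Lemma has_copy_sub (G : hypergraph) E F : E \subset F ->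
  has_copy G (Hypergraph E) -> has_copy G (Hypergraph F).
Proof.
move=> /subsetP sEF /existsP[/= f /andP[inj /forall_inP fE]].
by apply/existsP; exists f; rewrite inj; apply/forall_inP => e /fE/sEF.
Qed.

Lemma star_avoiding E A v l m :
  uniform_edges r E -> linear_edges E -> v \notin A ->
  l <= #|avoiding (edges_at E v) A| -> m <= l ->
  exists B, [/\ copy_on (linear_star r m) E B, [disjoint A & B] &
    #|B| <= (l * r.-1).+1].
Proof.
move=> uE lE vA lF ml.
have [B cB sB] := copy_star uE lE (avoiding_sub _ _) (leq_trans ml lF).
have cov : cover (avoiding (edges_at E v) A) \subset ~: A.
  by apply/bigcupsP => e; rewrite inE => /andP[_]; rewrite disjoints_subset.
have sB' : B \subset v |: ~: A by apply: subset_trans sB _; apply: setUS.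
have vsub : v |: ~: A = ~: A by apply/setUidPr; rewrite sub1set inE.
exists B; split=> //.
  by rewrite disjoint_sym disjoints_subset -vsub.
rewrite (copy_on_card cB) card_option card_prod !card_ord ltnS.
by rewrite leq_mul2r ml orbT.
Qed.

(** The star at u must also avoid the centres still to be used, so that these stay
    available; by linearity each forbidden vertex rules out at most one edge at u. *)
Lemma stars_high_degree E l ls G A U :
  uniform_edges r E -> linear_edges E -> all (leq^~ l) ls ->
  copy_on G E A -> [disjoint A & U] -> #|U| = size ls ->
  (forall u, u \in U ->
     #|A| + size ls * (l * r.-1).+1 + size ls + l <= #|edges_at E u|) ->
  has_copy (foldl hunion G [seq linear_star r m | m <- ls]) (Hypergraph E).
Proof.
move=> uE lE lsl cG dis cU deg; set c := (l * r.-1).+1 in deg.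
pose M := #|A| + size ls * c.
pose I j A' := #|A'| + j * c <= M /\ exists U',
  [/\ #|U'| = j, j <= size ls, [disjoint A' & U'] &
      forall u, u \in U' -> M + size ls + l <= #|edges_at E u|].
apply: (@copy_stars_greedily E l I _ ls G A) => //; last first.
  by split=> //; exists U.
move=> j A' m [cA' [U' [cU' jk dis' deg']]] ml.
have /card_gt0P[u uU] : 0 < #|U'| by rewrite cU'.
have uA : u \notin A' by rewrite (disjointFl dis' uU).
pose Z := A' :|: (U' :\ u).
have uZ : u \notin Z by rewrite !inE (negPf uA) eqxx.
have cZ : #|touching (edges_at E u) Z| <= #|Z|.
  apply: (@card_edges_through V E _ u) => //.
  - by apply/subsetP => e; rewrite !inE => /andP[/andP[]].
  - by move=> e; rewrite !inE => /andP[/andP[]].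
  move=> e /touchingP[_ [x xe xZ]]; exists x; split=> //.
  by apply: contraTneq xZ => ->.
have lF : l <= #|avoiding (edges_at E u) Z|.
  have := card_touching_avoiding (edges_at E u) Z; have := deg' u uU.
  have := (leq_card_setU A' (U' :\ u)).1; have := cardsD1 u U'.
  rewrite uU cU'; move: cZ cA' jk; rewrite -/Z mulSn.
  move: (j * c) #|touching _ _| #|avoiding _ _| #|edges_at _ _| #|Z| #|A'| #|U' :\ u|.
  by clear; lia.
have [B [cB disB szB]] := star_avoiding uE lE uZ lF ml.
exists B; split=> //.
  by apply: disjointWl disB; apply: subsetUl.
split.
  have := (leq_card_setU A' B).1; move: cA' szB; rewrite mulSn -/c.
  by move: #|A' :|: B| #|A'| #|B| (j * c) => ? ? ? ?; clear; lia.
exists (U' :\ u); split.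
- by have := cardsD1 u U'; rewrite uU cU' => -[].
- by apply: ltnW.
- rewrite disjoint_sym disjoints_subset setCU subsetI -!disjoints_subset.
  apply/andP; split; last by apply: disjointWl disB; apply: subsetUr.
  by rewrite disjoint_sym; apply: disjointWr dis'; apply: subsetDl.
by move=> w; rewrite inE => /andP[_]; apply: deg'.
Qed.

(** Stars with many edges survive the removal of any set as large as the one used
    by the path and all the stars, so the greedy choice never gets stuck. *)
Lemma stars_everywhere E l ls G A :
  uniform_edges r E -> linear_edges E -> all (leq^~ l) ls ->
  copy_on G E A ->
  (forall A', #|A'| <= #|A| + size ls * (l * r.-1).+1 ->
     exists2 v, v \notin A' & l <= #|avoiding (edges_at E v) A'|) ->
  has_copy (foldl hunion G [seq linear_star r m | m <- ls]) (Hypergraph E).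
Proof.
move=> uE lE lsl cG; set c := (l * r.-1).+1 => rich.
pose I j A' := #|A'| + j * c <= #|A| + size ls * c.
apply: (@copy_stars_greedily E l I _ ls G A) => //; last exact: leqnn.
move=> j A' m IA ml; have [|v vA lF] := rich A'.
  by apply: leq_trans IA; apply: leq_addr.
have [B [cB disB szB]] := star_avoiding uE lE vA lF ml.
exists B; split=> //; rewrite /I.
have := (leq_card_setU A' B).1; move: IA szB; rewrite /I mulSn -/c.
by move: #|A' :|: B| #|A'| #|B| (j * c) => ? ? ? ?; clear; lia.
Qed.

End Copies.

(** * The two cases of the main bound *)

Section Main.
Variables (V : finType) (r : nat).
Implicit Types (E F : {set {set V}}) (e f h : {set V}) (A B S U W : {set V}).

Lemma avoiding_cover E U : cover (avoiding E U) \subset ~: U.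
Proof. by apply/bigcupsP => e; rewrite inE disjoints_subset => /andP[]. Qed.

(** The number of vertices of a path with l0 edges and k stars with l edges, plus k
    reserved centres, plus the l edges that a further star needs. *)
Definition high_degree k l0 l :=
  (l0 * r.-1).+1 + k * (l * r.-1).+1 + k + l.

Lemma edges_many_high E l0 l ls U :
  2 < r -> 1 < l0 <= l -> uniform_edges r E -> linear_edges E ->
  all (leq^~ l) ls -> ~~ has_copy (path_stars r l0 ls) (Hypergraph E) ->
  #|U| = size ls ->
  (forall u, u \in U -> high_degree (size ls) l0 l <= #|edges_at E u|) ->
  2 * r * r.-1 * #|E| <= (2 * r * #|U| + (2 * r - 3) * l * r * r.-1) * #|~: U|
     + 2 * (#|U| * #|U|.-1).
Proof.
move=> r2 /andP[l01 l0l] uE lE lsl nocopy cU deg.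
have sub := avoiding_sub E U; have r1 : 1 < r by apply: ltnW.
have uE' := uniform_edges_sub sub uE; have lE' := linear_edges_sub sub lE.
have nop g : ~ path_in (avoiding E U) g l0.
  move=> hg; move/negP: nocopy; apply.
  have [A cA sA] := copy_path uE' lE' r1 (ltnW l01) hg.
  apply: (@stars_high_degree V r E l _ _ A U) => //.
  - exact: copy_on_sub cA.
  - rewrite disjoints_subset; apply: subset_trans sA (avoiding_cover _ _).
  by move=> u /deg; rewrite (copy_on_card cA) card_ord.
have h1 : 2 * #|avoiding E U| <= (2 * r - 3) * l0 * #|~: U|.
  apply: (linear_path_turan r2 l01 uE' lE' _ nop) => e.
  by rewrite inE disjoints_subset => /andP[].
have h2 := card_touching_pairs U uE lE.
rewrite -(card_touching_avoiding E U).
have h3 : (2 * r - 3) * l0 * #|~: U| <= (2 * r - 3) * l * #|~: U|.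
  by rewrite leq_mul2r leq_mul2l l0l !orbT.
have h4 := leq_mul (leqnn (r * r.-1)) (leq_trans h1 h3).
move: h2 h4; move: #|touching E U| #|avoiding E U| #|~: U| => a b d.
move: #|U| (2 * r - 3) => u w; move: (u * u.-1) (r.-1) => p q; clear; nia.
Qed.

(** Two sources of edges avoiding U are bounded together: those that meet a set A'
    of at most T vertices, at most T at each, and the rest, with all degrees below
    l. The case without a path with l0 edges is even better. *)
Lemma edges_few_high E l0 l ls :
  2 < r -> 1 < l0 <= l -> uniform_edges r E -> linear_edges E ->
  all (leq^~ l) ls -> ~~ has_copy (path_stars r l0 ls) (Hypergraph E) ->
  forall T U, T = high_degree (size ls) l0 l ->
  U = [set u | T <= #|edges_at E u|] ->
  2 * r * r.-1 * #|E| <=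
    (2 * r * #|U| + (2 * r - 3) * l * r * r.-1) * #|V| + 2 * r * r.-1 * (T * T).
Proof.
move=> r2 /andP[l01 l0l] uE lE lsl nocopy T U defT defU.
have sub := avoiding_sub E U; have r1 : 1 < r by apply: ltnW.
have uE' := uniform_edges_sub sub uE; have lE' := linear_edges_sub sub lE.
have h1 : r.-1 * #|touching E U| <= #|U| * #|V|.
  have := card_touching_pairs U uE lE; have := cardsC U; rewrite -cardsT.
  move: #|touching E U| #|~: U| => a b <-; have : 0 < r by apply: ltnW.
  move: #|U| => u; case: (r) => // q /= _; case: u => [|u] /=; clear.
    by nia.
  move=> h; rewrite -(leq_pmul2l (ltn0Sn q)) mulnA.
  by apply: leq_trans h _; nia.
have h2 : 2 * #|avoiding E U| <= (2 * r - 3) * l * #|V| + 2 * (T * T).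
  rewrite leqNgt; apply/negP => big.
  suff nop g : ~ path_in (avoiding E U) g l0.
    have := linear_path_turan r2 l01 uE' lE' (fun e _ => subsetT e) nop.
    rewrite cardsT leqNgt; apply/negP; rewrite negbK; apply: leq_ltn_trans big.
    by apply: leq_trans (leq_addr _ _); rewrite leq_mul2r leq_mul2l l0l !orbT.
  move=> hg; move/negP: nocopy; apply; apply: has_copy_sub sub _.
  have [A cA _] := copy_path uE' lE' r1 (ltnW l01) hg.
  apply: (stars_everywhere uE' lE' lsl cA) => A' cA'.
  apply/exists_inP; apply: contraLR big; rewrite negb_exists_in => /forall_inP poor.
  have dE' v : #|edges_at (avoiding E U) v| <= T.
    have sv : edges_at (avoiding E U) v \subset edges_at E v.
      by apply/subsetP => e; rewrite !inE => /andP[/andP[-> _] ->].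
    case: (boolP (v \in U)) => vU.
      rewrite (_ : edges_at _ _ = set0) ?cards0 //; apply/setP => e; rewrite !inE.
      apply/negP => /andP[/andP[_ dis] ve].
      by rewrite (disjointFr dis ve) in vU.
    apply: leq_trans (subset_leq_card sv) _.
    by move: vU; rewrite defU inE -ltnNge => /ltnW.
  have h2 := card_touching_deg (A := A') (fun v _ => dE' v).
  have cAT : #|A'| <= T.
    apply: leq_trans cA' _; rewrite (copy_on_card cA) card_ord defT /high_degree.
    by rewrite -addnA leq_addr.
  have h3 : #|avoiding (avoiding E U) A'| <= #|V| * l.
    rewrite -cardsT; apply: (@leq_trans #|touching (avoiding (avoiding E U) A') setT|).
      apply/subset_leq_card/subsetP => e eE'; apply/touchingP; split=> //.
      have /card_gt0P[x xe] : 0 < #|e|.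
        have /uniform_edges_sub/(_ uE') -> // := avoiding_sub (avoiding E U) A'.
        by apply: ltnW.
      by exists x; rewrite ?inE.
    apply: card_touching_deg => v _; case: (boolP (v \in A')) => vA.
      rewrite (_ : edges_at _ _ = set0) ?cards0 //; apply/setP => e; rewrite !inE.
      apply/negP => /andP[/andP[_ dis] ve].
      by rewrite (disjointFr dis ve) in vA.
    have := poor v vA; rewrite -ltnNge => /ltnW; congr (_ <= _); apply: eq_card => e.
    by rewrite !inE andbAC.
  rewrite -leqNgt -(card_touching_avoiding (avoiding E U) A').
  have h4 := leq_trans h2 (leq_mul cAT (leqnn T)).
  have h5 : 2 * (#|V| * l) <= (2 * r - 3) * l * #|V|.
    rewrite [#|V| * l]mulnC mulnA leq_mul2r leq_mul2r; apply/orP; right.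
    by apply/orP; right; clear -r2; lia.
  rewrite mulnDr addnC; apply: leq_add; last by rewrite leq_mul2l.
  by apply: leq_trans h5; rewrite leq_mul2l.
rewrite -(card_touching_avoiding E U) -mulnA.
have h3 := leq_mul (leqnn (2 * r)) h1; have h4 := leq_mul (leqnn (r * r.-1)) h2.
move: h3 h4; move: #|touching E U| #|avoiding E U| #|V| => a b d.
move: #|U| (2 * r - 3) (T * T) => u w p; clear; nia.
Qed.

End Main.

Lemma uniform_edges_of_uniform (r : nat) (V : finType) (E : {set {set V}}) :
  uniform r (Hypergraph E) -> uniform_edges r E.
Proof. by move=> /forall_inP uE e /uE/eqP. Qed.

Lemma linear_edges_of_linear (V : finType) (E : {set {set V}}) :
  linear_hypergraph (Hypergraph E) -> linear_edges E.
Proof.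
move=> /forall_inP lE e f x y eE fE xy xe ye xf yf.
apply/eqP; have /forall_inP/(_ f fE) := lE e eE; apply: contraTT => ef.
rewrite ef -ltnNge; apply/card_gt1P; exists x, y.
by rewrite !inE xe ye xf yf.
Qed.

(** The bound multiplied by 2r(r-1), so that it lives in the natural numbers. The
    threshold N makes the gap of one full vertex of U, worth 2rn, cover the loss
    from n to n - k and the additive constant of [edges_few_high]. *)
Lemma edges_bound (r l0 l : nat) (ls : seq nat) :
  2 < r -> 1 < l0 <= l -> all (leq^~ l) ls ->
  exists2 N, size ls <= N & forall (V : finType) (E : {set {set V}}), N <= #|V| ->
    uniform_edges r E -> linear_edges E -> ~~ has_copy (path_stars r l0 ls) (Hypergraph E) ->
    2 * r * r.-1 * #|E| <=
      (2 * r * size ls + (2 * r - 3) * l * r * r.-1) * (#|V| - size ls)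
      + 2 * (size ls * (size ls).-1).
Proof.
move=> r2 hl lsl; set k := size ls.
pose D := (2 * r - 3) * l * r * r.-1; pose T := high_degree r k l0 l.
exists (k + (k * (2 * r * k + D) + 2 * r * r.-1 * (T * T))); first exact: leq_addr.
move=> V E; set n := #|V| => nN uE lE nocopy; rewrite -/D.
pose U := [set u | T <= #|edges_at E u|].
case: (leqP k #|U|) => [/card_geqP[s [us ss sU]]|Uk].
  pose U' := [set x in s].
  have cU' : #|U'| = k by rewrite cardsE (card_uniqP us).
  have cC : #|~: U'| = n - k by rewrite cardsCs setCK cU'.
  rewrite -cC -cU'; apply: (edges_many_high r2 hl uE lE lsl nocopy) => // u.
  by rewrite inE => /sU; rewrite inE.
apply: leq_trans (leq_addr _ _).
apply: leq_trans (edges_few_high r2 hl uE lE lsl nocopy erefl erefl) _.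
rewrite -/k -/T -/U -/n -/D; move: (2 * r * r.-1 * _) nN Uk => C.
have : 0 < r by apply: ltnW (ltnW r2).
move: #|U| => u; case: (r) => // q _; clear; move: D => d nN Uk.
have -> : n = k + (n - k) by rewrite subnKC //; apply: leq_trans nN; apply: leq_addr.
have : k * (2 * q.+1 * k + d) + C <= n - k by move: nN; clear; lia.
rewrite addKn; move: (n - k) => w hw.
have h1 : u.+1 * (w + k) <= k * (w + k) by rewrite leq_mul2r Uk orbT.
nia.
Qed.

Import Order.TTheory GRing.Theory Num.Theory.
Local Open Scope ring_scope.

Theorem theorem1p2 (r l0 k : nat) (ls : k.-tuple nat)
    (hr : (3 <= r)%N) (hl0 : (4 <= l0)%N)
    (hpos : forall i : 'I_k, (0 < tnth ls i)%N)
    (hsorted : forall i j : 'I_k, (i <= j)%N -> (tnth ls j <= tnth ls i)%N) :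
  let l := if tval ls is l1 :: _ then maxn l0 l1 else l0 in
  exists N : nat, forall n : nat, (N <= n)%N ->
    (ex_lin r n (path_stars r l0 ls))%:R <=
      (k%:R / (r%:R - 1) + (2 * r%:R - 3) * l%:R / 2) * (n%:R - k%:R)
      + k%:R * (k%:R - 1) / (r%:R * (r%:R - 1)) :> rat.
Proof.
move=> l.
have hl : (1 < l0 <= l)%N.
  rewrite (leq_trans _ hl0) //= /l; case: (tval ls) => // l1 _.
  exact: leq_maxl.
have lsl : all (leq^~ l) ls.
  apply/allP => _ /tnthP[i ->]; rewrite /l.
  case: k ls i {hpos l hl} hsorted => [|k'] ls; first by case.
  case/tupleP: ls => l1 ls i /(_ ord0 i (leq0n i)); rewrite tnth0 /= => h.
  exact: leq_trans h (leq_maxr _ _).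
have [N kN bound] := edges_bound hr hl lsl; rewrite size_tuple in kN bound.
exists N => n nN; set m := ex_lin _ _ _.
have key : (2 * r * r.-1 * m <=
    (2 * r * k + (2 * r - 3) * l * r * r.-1) * (n - k) + 2 * (k * k.-1))%N.
  rewrite /m /ex_lin; apply: (big_ind (fun x => _ * x <= _)%N); first by rewrite muln0.
    by move=> x y hx hy; case: (leqP x y).
  move=> E /and3P[/uniform_edges_of_uniform uE /linear_edges_of_linear lE fE].
  by have := bound _ E; rewrite card_ord; apply.
have kn : (k <= n)%N := leq_trans kN nN.
have hk : k%:R * k.-1%:R = k%:R * (k%:R - 1) :> rat.
  by case: (k) => [|k']; rewrite ?mul0r // -[k'.+1.-1]/k' -natr1 addrK.
move: key; rewrite -(ler_nat rat) natrD !natrM hk natrB // natrD !natrM.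
rewrite natrB; last by apply: leq_trans (leq_mul (leqnn 2) hr).
rewrite natrM -subn1 natrB ?(leq_trans _ hr) //.
have r0 : 0 < r%:R :> rat by rewrite ltr0n (leq_trans _ hr).
have r1 : 0 < r%:R - 1 :> rat by rewrite subr_gt0 ltr1n (leq_trans _ hr).
move: (r%:R) (k%:R) (l%:R) (n%:R) (m%:R) r0 r1 => R K L n' M r0 r1 key.
have c0 : 0 < 2 * R * (R - 1) by rewrite !mulr_gt0.
rewrite -(ler_pM2l c0); apply: le_trans key _; rewrite le_eqVlt; apply/orP; left.
apply/eqP; field; by rewrite !gt_eqF.
Qed.
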